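(* Let $(X_t)_{t\in\mathbb{R}}$ be a measurable stationary real-valued stochastic process on a standard (Lebesgue) probability space $(\Omega,\mathcal{F},\mathbb{P})$. Then the following alternative holds: either $(X_t)_{t\in\mathbb{R}}$ is sample continuous, or for every non-null set $T\subset\mathbb{R}$ the restricted process $(X_t)|_T$ does not have a natural modification.
   Context: A set $T\subset\mathbb{R}$ (not necessarily measurable) is non-null if its Lebesgue outer measure is positive. $(X_t)|_T$ denotes the process $(X_t)_{t\in T}$, the restriction to the time set $T$. A modification of a real-valued process $(X_t)_{t\in T}$ on $(\Omega,\mathcal{F},\mathbb{P})$ is a map $\xi:\Omega\to\mathbb{R}^T$ such that for each $t\in T$, $\xi(\omega)(t)=X_t(\omega)$ for almost every $\omega$. A modification $\xi$ is called natural if there exists a second countable topology $\mathcal{T}$ on the set $T$ such that for almost every $\omega\in\Omega$ the function $\xi(\omega):T\to\mathbb{R}$ is $\mathcal{T}$-continuous. The process $(X_t)_{t\in\mathbb{R}}$ is sample continuous if it has a modification $\xi$ such that for almost every $\omega$ the path $\xi(\omega)$ is continuous on $\mathbb{R}$ in the usual topology. The process $(X_t)_{t\in\mathbb{R}}$ is measurable if it has a modification $f(\omega,t)$ that is jointly measurable on $\Omega\times\mathbb{R}$ with respect to $\mathcal{F}\otimes\mathcal{B}$, where $\mathcal{B}$ is the Lebesgue $\sigma$-algebra of $\mathbb{R}$. It is stationary if for all $s,t_1,\dots,t_n\in\mathbb{R}$ the vectors $(X_{s+t_1},\dots,X_{s+t_n})$ and $(X_{t_1},\dots,X_{t_n})$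 have the same distribution. *)

(* Defs.v *)
From HB Require Import structures.
From mathcomp Require Import all_boot all_order all_algebra.
From mathcomp Require Import all_classical all_reals all_analysis.
Import Order.TTheory GRing.Theory Num.Theory.
Import numFieldNormedType.Exports.

Set Implicit Arguments.
Unset Strict Implicit.
Unset Printing Implicit Defensive.

Local Open Scope classical_set_scope.
Local Open Scope ring_scope.

(* [lebesgue_outer] is defined on all subsets of R; [completed_lebesgue_measure]
   is the same function, and its domain [lebesgueType R] is R with the
   sigma-algebra of Lebesgue measurable (= Caratheodory measurable) sets,
   whereas R itself carries the Borel sigma-algebra. *)
Notation lebesgue_outer R := ((wlength (@idfun (Real.sort R)))^*)%mu.
Notation lebesgueType R := (caratheodory_type (lebesgue_outer R)).

Definition non_null (R : realType) (T : set R) : Prop :=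
  (0 < lebesgue_outer R T)%E.

Section standard.
Context {R : realType}.

(* The measures are plain set functions, so that the model measure below need
   not be packaged; f is only relevant on A0. *)
Definition isomorphic_mod0 d d' (A : measurableType d) (B : measurableType d')
    (mu : set A -> \bar R) (nu : set B -> \bar R) : Prop :=
  exists (f : A -> B) (A0 : set A) (B0 : set B),
    [/\ measurable A0 /\ mu (~` A0) = 0%E,
        measurable B0 /\ nu (~` B0) = 0%E,
        set_bij A0 B0 f,
        forall S, S `<=` A0 -> measurable S <-> measurable (f @` S) &
        forall S, S `<=` A0 -> measurable S -> mu S = nu (f @` S)].

(* Lebesgue measure on [0, a] plus atoms of mass p n at the points -(n+1),
   which lie outside [0, a]; a = 0 means no continuous part, p n = 0 means no
   n-th atom. *)
Definition interval_atoms (a : R) (p : nat -> R) (S : set (lebesgueType R))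
    : \bar R :=
  (completed_lebesgue_measure (S `&` `[0%R, a%R]) +
   \sum_(0 <= n <oo) (p n)%:E * \d_((- n.+1%:R : R)%R : lebesgueType R) S)%E.

(* Total mass 1 of the model, i.e. a + \sum_n p n = 1, is forced by the
   isomorphism with the probability P. *)
Definition standard_probability d (Omega : measurableType d)
    (P : probability Omega R) : Prop :=
  measure_is_complete P /\
  exists (a : R) (p : nat -> R),
    [/\ 0 <= a, forall n, 0 <= p n & isomorphic_mod0 P (interval_atoms a p)].

End standard.

Section processes.
Context {R : realType} d {Omega : measurableType d} (P : probability Omega R).

(* The index type I is R, or a set T : set R coerced to a type. *)
Definition modification (I : Type) (X : I -> {RV P >-> R})
    (xi : Omega -> I -> R) : Prop :=
  forall t, {ae P, forall w, xi w t = X t w}.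

(* [c] ranges over all topologies on I, whatever canonical topology I may
   already have. *)
Definition natural (I : Type) (xi : Omega -> I -> R) : Prop :=
  exists c : Topological.axioms_ I,
    let I_c : topologicalType := Topological.Pack c in
    @second_countable I_c /\
    {ae P, forall w, continuous (xi w : I_c -> R)}.

Definition has_natural_modification (I : Type) (X : I -> {RV P >-> R}) : Prop :=
  exists2 xi, modification X xi & natural xi.

Definition sample_continuous (X : R -> {RV P >-> R}) : Prop :=
  exists2 xi, modification X xi & {ae P, forall w, continuous (xi w : R -> R)}.

Definition measurable_process (X : R -> {RV P >-> R}) : Prop :=
  exists2 xi, modification X xi &
    measurable_fun [set: Omega * lebesgueType R]
      (fun wt : Omega * lebesgueType R => xi wt.1 wt.2).

Section finite_dimensional.
Variables (X : R -> {RV P >-> R}) (n : nat) (t : n.-tuple R).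

Definition fdd_vector (w : Omega) : n.-tuple R := [tuple X (tnth t i) w | i < n].

Lemma measurable_fdd_vector : measurable_fun setT fdd_vector.
Proof.
apply/measurable_fun_tnthP => i.
rewrite (_ : _ \o _ = X (tnth t i)); first exact: measurable_funPT.
by apply/funext => w /=; rewrite tnth_mktuple.
Qed.

HB.instance Definition _ :=
  isMeasurableFun.Build _ _ _ _ fdd_vector measurable_fdd_vector.

End finite_dimensional.

(* Distributions are compared on measurable sets only: [distribution] has no
   meaning on the other ones. *)
Definition stationary (X : R -> {RV P >-> R}) : Prop :=
  forall (n : nat) (s : R) (t : n.-tuple R) (B : set (n.-tuple R)),
    measurable B ->
    distribution P (fdd_vector X [tuple s + tnth t i | i < n]) B =
    distribution P (fdd_vector X t) B.

End processes.

(* Main.v *)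
Require Import Defs.
From HB Require Import structures.
From mathcomp Require Import all_boot all_order all_algebra.
From mathcomp Require Import all_classical all_reals all_analysis.
From mathcomp Require Import measurable_realfun ring lra.
Import Order.TTheory GRing.Theory Num.Theory.
Import numFieldNormedType.Exports.

Set Implicit Arguments.
Unset Strict Implicit.
Unset Printing Implicit Defensive.

Local Open Scope classical_set_scope.
Local Open Scope ring_scope.

(* Suppose X|T has a natural modification with T non-null, and fix e > 0. A
   countable base (U_n) of the topology of T gives, for almost every w, the
   property that every t in T lies in some U_n on which the path w oscillates
   by at most e. Only the values at a countable set of times enter this
   property, so on a standard space it contains an event of full probability
   depending on the law of these values only; by stationarity and Fubini it
   then holds, for almost every w, along X_{h + .} for almost every h.

   Let F_n be the closure of U_n. A measurable stationary process is continuous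
   in probability, so small oscillation on h + U_n passes to h + F_n. Fix such a
   w and a real x. The set x - T is non-null and is covered, up to a null set,
   by the measurable sets
     M_n = {h | x - h in F_n, oscillation of w on h + U_n at most e},
   hence some M_n has positive measure. By a Steinhaus argument M_n meets its
   translates by x - y and x - y' for all y, y' close to x, which yields h with
   y, y' in h + F_n, so |X_y - X_y'| <= e. Thus the path restricted to any
   countable set of times has zero oscillation at every real point, and it
   extends continuously from the rationals to the line. *)

(** * Lebesgue outer measure: isometries and a Steinhaus property *)

Lemma natSinv_lt {R : realType} (e : R) : 0 < e -> exists k, k.+1%:R^-1 < e.
Proof.
move=> e0; have [k _ /(_ k (leqnn k))] := near_infty_natSinv_lt (PosNum e0).
by exists k.
Qed.

Section lebesgue.
Context {R : realType}.
Local Notation L := (lebesgue_outer R).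
Local Notation mirror x := (fun t : R => x - t).
Local Notation shift v := (fun t : R => t + v).
Implicit Types (A K M : set R) (x y v : R).

Lemma Borel_Lebesgue A : measurable A -> measurable (A : set (lebesgueType R)).
Proof. exact: sub_caratheodory. Qed.

Lemma measurable_sub_cst x : measurable_fun setT (fun t : R => x - t).
Proof. exact: measurable_funB. Qed.

(** Reflections come first because every translation is a composite of two of them: t + v = v - (0 -
    t). *)
Lemma lebesgue_measure_reflect x A : measurable A ->
  lebesgue_measure (mirror x @^-1` A) = lebesgue_measure A.
Proof.
move=> mA; have mf : measurable_fun setT
    (mirror x : measurableTypeR R -> measurableTypeR R).
  exact: measurable_sub_cst.
suff -> : lebesgue_measure A = pushforward lebesgue_measure
  (mirror x : measurableTypeR R -> measurableTypeR R) A by [].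
apply: lebesgue_measure_unique => //= _ [[a b] _ <-]; rewrite /pushforward /=.
have -> : (mirror x) @^-1` `]a, b] = `[x - b, x - a[%classic.
  by apply/seteqP; split => t /=; rewrite !in_itv /=; lra.
rewrite !lebesgue_measure_itv /= !lte_fin ltrD2l ltrN2 -!EFinB.
by case: ifP => // _; congr (_%:E); ring.
Qed.

(** Outer regularity carries the invariance from open sets to arbitrary ones. The inequality
    suffices, a reflection being an involution. *)
Lemma outer_reflect_le x A : (L (mirror x @^-1` A) <= L A)%E.
Proof.
apply/lee_addgt0Pr => e e0.
have [U [oU AU UA]] := outer_measure_open_le A e0.
apply: le_trans UA; rewrite -(lebesgue_measure_reflect x); last first.
  exact: open_measurable.
by apply: le_outer_measure; exact: preimage_subset.
Qed.

Lemma outer_reflect x A : L (mirror x @^-1` A) = L A.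
Proof.
apply/eqP; rewrite eq_le outer_reflect_le /=.
rewrite (le_trans _ (outer_reflect_le x _)) // -comp_preimage.
rewrite le_outer_measure // => t At /=.
by rewrite opprB addrC subrK.
Qed.

Lemma outer_shift v A : L (shift v @^-1` A) = L A.
Proof.
rewrite -[RHS](outer_reflect v) -[RHS](outer_reflect 0) -comp_preimage.
by rewrite (_ : shift v = mirror v \o mirror 0)//; apply/funext => t /=; ring.
Qed.

(** The Caratheodory criterion for the preimage, tested on X, is the criterion for A tested on the
    reflection of X. *)
Lemma measurable_Lebesgue_reflect x :
  measurable_fun setT (mirror x : lebesgueType R -> lebesgueType R).
Proof.
move=> _ A mA; rewrite setTI.
suff mxA X : L X = (L (X `&` mirror x @^-1` A) + L (X `&` ~` (mirror x @^-1` A)))%E.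
  exact: mxA.
have mirrorK (B : set R) : mirror x @^-1` (mirror x @^-1` B) = B.
  rewrite -comp_preimage (_ : _ \o _ = id)//.
  by apply/funext => t /=; ring.
have /= := mA (mirror x @^-1` X); rewrite outer_reflect => ->.
rewrite -(outer_reflect x (X `&` mirror x @^-1` A)).
rewrite -(outer_reflect x (X `&` ~` (mirror x @^-1` A))).
by rewrite !preimage_setI preimage_setC !mirrorK.
Qed.

Lemma measurable_Lebesgue_shift v :
  measurable_fun setT (shift v : lebesgueType R -> lebesgueType R).
Proof.
rewrite (_ : shift v = mirror v \o mirror 0); last first.
  by apply/funext => t /=; ring.
apply: (@measurableT_comp _ _ _ _ (lebesgueType R)); exact: measurable_Lebesgue_reflect.
Qed.

(** The Lebesgue sigma-algebra is the completion of the Borel one. *)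
Lemma Lebesgue_measurable_Borel M : measurable (M : set (lebesgueType R)) ->
  exists B, [/\ measurable B, B `<=` M & L (M `\` B) = 0%E].
Proof.
rewrite -completed_caratheodory_measurable g_sigma_completed_algebra_genE.
move=> [B mB [N nN <-]]; exists B; split => //.
apply/negligible_outer_measure; apply: negligibleS nN.
by move=> t [[]].
Qed.

Lemma Lebesgue_inner_compact M (e : R) : measurable (M : set (lebesgueType R)) ->
  (L M < +oo)%E -> 0 < e ->
  exists K, [/\ compact K, K `<=` M & (L (M `\` K) < e%:E)%E].
Proof.
move=> mM Moo e0; have [B [mB BM MB0]] := Lebesgue_measurable_Borel mM.
have [|K [cK KB Ke]] := lebesgue_regularity_inner mB _ e0.
  by apply: le_lt_trans Moo; exact: le_outer_measure.
exists K; split => //; first exact: subset_trans BM.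
apply: le_lt_trans Ke; rewrite -[leRHS]add0e -MB0.
apply: le_trans (outer_measureU2 _ _ _); apply: le_outer_measure => t [Mt Kt].
by have [Bt|Bt] := pselect (B t); [right|left].
Qed.

(** Take K compact inside M and U open around K, each with error below e/2. For small v the
    translate of K stays in U, so what is lost from M lies in M minus K or in U minus that
    translate. *)
Lemma shift_diff_small M (e : R) : measurable (M : set (lebesgueType R)) ->
  (L M < +oo)%E -> 0 < e ->
  exists2 eta : R, 0 < eta & forall v, `|v| < eta ->
    (L (M `\` shift v @^-1` M) < e%:E)%E.
Proof.
move=> mM Moo e0; have e20 : 0 < e / 2 by rewrite divr_gt0.
have [K [cK KM MK]] := Lebesgue_inner_compact mM Moo e20.
have mK : measurable K by exact: compact_measurable.
have Koo := compact_finite_measure cK.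
have [U [oU KU UK]] := lebesgue_regularity_outer mK Koo e20.
have UKoo : (L U < +oo)%E.
  rewrite -(setDUK KU); apply: le_lt_trans (outer_measureU2 _ _ _) _.
  by rewrite lte_add_pinfty// (lt_trans UK)// ltry.
(* Compactness turns the neighbourhoods of 0 found at each point of K into a single one. *)
have /(compact_near_coveringP K).1 : compact K by [].
move=> /(_ _ (nbhs (0:R)) (fun v t => U (t - v)) _) [].
  move=> t /KU Ut.
  have : (fun z : R * R => z.1 - z.2) @ nbhs (t, 0:R) --> t - 0.
    by apply: cvgB; [exact: cvg_fst|exact: cvg_snd].
  rewrite subr0 => /(_ U); apply; exact: open_nbhs_nbhs.
move=> eta eta0 etaP; exists eta => // v vlt.
have KvU : shift v @^-1` K `<=` U.
  move=> t /= Ktv; rewrite -(addrK v t); apply: etaP => //=.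
  by rewrite sub0r normrN.
have mKv : measurable (shift v @^-1` K).
  rewrite -[X in measurable X]setTI.
  by apply: (@measurable_funD _ _ R setT idfun (cst v)) => //; exact: measurable_id.
have h : (L (M `\` shift v @^-1` M) <= L (M `\` K) + L (U `\` shift v @^-1` K))%E.
  apply: le_trans (outer_measureU2 _ _ _); apply: le_outer_measure => t [Mt Mvt].
  have [Kt|Kt] := pselect (K t); last by left.
  by right; split; [exact: KU|move=> /KM].
apply: le_lt_trans h _.
have -> : L (U `\` shift v @^-1` K) = L (U `\` K).
  transitivity (lebesgue_measure U - lebesgue_measure K)%E.
    rewrite -[X in _ = (_ - X)%E](outer_shift v).
    rewrite -[LHS]/(lebesgue_measure _) measureD ?setIidr//.
    exact: open_measurable.
  rewrite -[RHS]/(lebesgue_measure _) measureD ?setIidr//.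
  exact: open_measurable.
by rewrite [e]splitr EFinD lteD.
Qed.

(** Inside a bounded part N of M of positive measure, each small shift loses less than half of
    [L N], so the triple intersection is not null. Two translates are taken because one h will have
    to serve two times. *)
Lemma steinhaus3 M : measurable (M : set (lebesgueType R)) -> (0 < L M)%E ->
  exists2 eta : R, 0 < eta & forall v w, `|v| < eta -> `|w| < eta ->
    (0 < L (M `&` shift v @^-1` M `&` shift w @^-1` M))%E.
Proof.
move=> mM M0.
have {M0} [n M0] : exists n, (0 < L (M `&` `[(- n%:R)%R, (n%:R)%R]%classic))%E.
  apply: contrapT => /forallNP h; move: M0; rewrite ltNge => /negP; apply.
  rewrite -[M]setIT -(bigcup_itvT true false) setI_bigcupr.
  apply: le_trans (outer_measure_sigma_subadditive _ _) _.
  rewrite eseries0// => k _ _; apply/eqP; rewrite -measure_le0 leNgt.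
  by apply/negP; exact: h.
set N := M `&` _ in M0.
have mN : measurable (N : set (lebesgueType R)).
  by apply: measurableI => //; exact: Borel_Lebesgue.
have Noo : (L N < +oo)%E.
  apply: (@le_lt_trans _ _ (L `[(- n%:R)%R, (n%:R)%R]%classic)).
    by apply: le_outer_measure; exact: subIsetr.
  rewrite -[L _]/(lebesgue_measure _) lebesgue_measure_itv /=.
  by case: ifP; rewrite ?ltry.
have Nfin : L N \is a fin_num by rewrite ge0_fin_numE ?outer_measure_ge0.
have N0 : 0 < fine (L N) / 2 by rewrite divr_gt0// fine_gt0// M0 Noo.
have [eta eta0 etaP] := shift_diff_small mN Noo N0.
exists eta => // v w /etaP Nv /etaP Nw.
rewrite lt_neqAle outer_measure_ge0 andbT; apply/eqP => /esym I0.
have : (L N < L N)%E; last by rewrite ltxx.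
rewrite -{2}(fineK Nfin) [fine _]splitr EFinD.
apply: le_lt_trans (lteD Nv Nw).
rewrite -[leRHS]add0e -I0.
apply: le_trans; last by apply: leeD2l; exact: outer_measureU2.
apply: le_trans (outer_measureU2 _ _ _); apply: le_outer_measure => t Nt.
have [Nvt|Nvt] := pselect (N (t + v)); last by right; left.
have [Nwt|Nwt] := pselect (N (t + w)); last by right; right.
by left; split; [split|]; [case: Nt|case: Nvt|case: Nwt].
Qed.

End lebesgue.

(** * Laws of sequences of random variables *)

Section path_space.
Context {R : realType}.
Implicit Types (y : nat -> R).

Definition prefix n y : n.-tuple R := [tuple y i | i < n].

Definition cylinders : set (set (nat -> R)) :=
  [set C | exists n (B : set (n.-tuple R)), measurable B /\ C = prefix n @^-1` B].

(** This is the product sigma-algebra on real sequences. *)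
Definition sequence_space := g_sigma_algebraType cylinders.

Lemma measurable_fun_sequence d (T : measurableType d) (g : T -> nat -> R) :
  (forall i, measurable_fun setT (g ^~ i)) ->
  measurable_fun setT (g : T -> sequence_space).
Proof.
move=> mg; apply: (@measurability _ _ T sequence_space setT _ cylinders erefl).
move=> _ [_ [n [B [mB ->]]] <-]; rewrite -comp_preimage.
have : measurable_fun setT (prefix n \o g).
  apply/measurable_fun_tnthP => i.
  rewrite (_ : _ \o _ = g ^~ i) //; apply/funext => t /=.
  by rewrite tnth_mktuple.
exact.
Qed.

Lemma measurable_coordinate i :
  measurable_fun setT (fun y : sequence_space => (y : nat -> R) i).
Proof.
move=> _ B mB; rewrite setTI; apply: sub_sigma_algebra.
exists i.+1, ((@tnth i.+1 R)^~ ord_max @^-1` B); split.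
  by rewrite -[X in measurable X]setTI; exact: measurable_tnth.
by apply/seteqP; split => y /=; rewrite tnth_mktuple.
Qed.

(** Both cylinders are rewritten over prefixes of length [m + n]. Cylinders thus form a pi-system,
    as the uniqueness of measures requires. *)
Lemma cylinders_setI : setI_closed cylinders.
Proof.
move=> _ _ [m [B [mB ->]]] [n [C [mC ->]]].
pose restr p q (le_pq : (p <= q)%N) (z : q.-tuple R) : p.-tuple R :=
  [tuple tnth z (widen_ord le_pq i) | i < p].
have mrestr p q (le_pq : (p <= q)%N) : measurable_fun setT (restr p q le_pq).
  apply/measurable_fun_tnthP => i.
  rewrite (_ : _ \o _ = (@tnth q R)^~ (widen_ord le_pq i)).
    exact: measurable_tnth.
  by apply/funext => t /=; rewrite tnth_mktuple.
have restr_prefix p q (le_pq : (p <= q)%N) y :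
    restr p q le_pq (prefix q y) = prefix p y.
  by apply: eq_from_tnth => i; rewrite !tnth_mktuple.
exists (m + n)%N, (restr _ _ (leq_addr n m) @^-1` B `&`
  restr _ _ (leq_addl m n) @^-1` C); split.
  by apply: measurableI; rewrite -[X in measurable X]setTI; exact: mrestr.
by apply/seteqP; split => y /=; rewrite !restr_prefix.
Qed.

Lemma cylindersT : cylinders setT.
Proof. by exists 0%N, setT; rewrite preimage_setT; split. Qed.

Context d {Omega : measurableType d} (P : probability Omega R).

Lemma cylinder_law_unique (X Y : nat -> {RV P >-> R}) :
  (forall n (B : set (n.-tuple R)), measurable B ->
    P [set w | B (prefix n (X ^~ w))] = P [set w | B (prefix n (Y ^~ w))]) ->
  forall A : set sequence_space, measurable A ->
    P [set w | A (X ^~ w)] = P [set w | A (Y ^~ w)].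
Proof.
move=> XY A mA.
have mZ (Z : nat -> {RV P >-> R}) :
    measurable_fun setT ((fun w => Z ^~ w) : Omega -> sequence_space).
  by apply: measurable_fun_sequence => i; exact: measurable_funP.
pose S Z : {mfun Omega >-> sequence_space} := mfun_Sub (mem_set (mZ Z)).
suff : distribution P (S X) A = distribution P (S Y) A by [].
apply: (@measure_unique _ R sequence_space cylinders (fun=> setT) erefl
  cylinders_setI _ _ (distribution P (S X)) (distribution P (S Y))) => //.
- by move=> _; exact: cylindersT.
- by rewrite bigcup_const//; exists 0%N.
- by move=> _ [n [B [mB ->]]]; exact: XY.
- by move=> _; rewrite -[X in (X < _)%E]/(P setT) probability_setT ltry.
Qed.

(** Stationarity speaks of finite vectors; uniqueness on cylinders extends it to events that depend
    on countably many times. *)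
Lemma stationary_sequence_law (X : R -> {RV P >-> R}) (c : nat -> R) (h : R)
    (A : set sequence_space) : stationary X -> measurable A ->
  P [set w | A (fun i => X (h + c i) w)] = P [set w | A (fun i => X (c i) w)].
Proof.
move=> statX.
apply: (cylinder_law_unique (X := fun i => X (h + c i)) (Y := fun i => X (c i))).
move=> n B mB.
have := statX n h [tuple c i | i < n] B mB.
have E (u : n.-tuple R) (u' : nat -> R) : (forall i, tnth u i = u' i) ->
    distribution P (fdd_vector X u) B =
    P [set w | B (prefix n (fun i => X (u' i) w))].
  move=> uu'; rewrite /distribution /pushforward; congr (P _).
  apply/seteqP; split => w /=.
    rewrite (_ : fdd_vector X u w = prefix n (fun i => X (u' i) w))//.
    by apply: eq_from_tnth => i; rewrite !tnth_mktuple uu'.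
  rewrite (_ : prefix n (fun i => X (u' i) w) = fdd_vector X u w)//.
  by apply: eq_from_tnth => i; rewrite !tnth_mktuple uu'.
rewrite (E _ (fun i => h + c i)) ?(E _ c) // => i; rewrite !tnth_mktuple//.
Qed.

End path_space.

(** * Fubini and continuity in probability *)

Section joint_measurability.
Context {R : realType} d {Omega : measurableType d} (P : probability Omega R).
Local Notation L := (lebesgue_outer R).
Local Notation OmegaR := (Omega * lebesgueType R)%type.

Lemma fubini_indic (A : set OmegaR) : measurable A ->
  (\int[P]_w L (xsection A w) = \int[completed_lebesgue_measure]_h P (ysection A h))%E.
Proof.
move=> mA; have := indic_fubini_tonelli P (@completed_lebesgue_measure R) mA.
by rewrite indic_fubini_tonelli_FE// indic_fubini_tonelli_GE.
Qed.

(** By Tonelli the nonnegative function [L (xsection A w)] of w has integral 0. *)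
Lemma ae_negligible_xsection (A : set OmegaR) : measurable A ->
  (forall h, P (ysection A h) = 0%E) -> {ae P, forall w, L (xsection A w) = 0%E}.
Proof.
move=> mA A0.
have mF : measurable_fun setT (fun w => L (xsection A w)).
  exact: (@measurable_fun_xsection _ _ _ _ _ (@completed_lebesgue_measure R)).
have := (@ae_eq_integral_abs _ _ _ P setT measurableT _ mF).1.
rewrite (eq_integral (fun w => L (xsection A w))); last first.
  by move=> w _; rewrite gee0_abs// outer_measure_ge0.
rewrite fubini_indic// (eq_integral (cst 0%E)) ?integral0; last first.
  by move=> h _; exact: A0.
move=> /(_ erefl); apply: filterS => w /(_ I); exact.
Qed.

Lemma ae_eq_probability (A B : set Omega) : measurable A -> measurable B ->
  {ae P, forall w, A w <-> B w} -> P A = P B.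
Proof.
move=> mA mB [N [mN N0 ABN]].
have le (C D : set Omega) : measurable C -> measurable D ->
    (forall w, ~ N w -> C w -> D w) -> (P C <= P D)%E.
  move=> mC mD CD; rewrite -[leRHS]adde0 -N0.
  apply: le_trans (measureU2 _ mD mN); apply: le_measure; rewrite ?inE//.
    exact: measurableU.
  move=> w Cw; have [Nw|Nw] := pselect (N w); first by right.
  by left; exact: CD.
have AB w : ~ N w -> A w <-> B w by move=> nN; apply: contrapT => /ABN.
by apply/eqP; rewrite eq_le !le// => w /AB [].
Qed.

Context (X : R -> {RV P >-> R}) (f : Omega -> R -> R).
Hypotheses (Xf : modification X f)
  (mf : measurable_fun [set: OmegaR] (fun wt : OmegaR => f wt.1 wt.2))
  (statX : stationary X).

Lemma measurable_fun_section t : measurable_fun setT (f ^~ t).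
Proof. exact: (measurable_fun_pair1 (t : lebesgueType R) mf). Qed.

Lemma measurable_fun_shifted s :
  measurable_fun [set: OmegaR] (fun wt : OmegaR => f wt.1 (wt.2 + s)).
Proof.
have mG : measurable_fun [set: OmegaR]
    (fun wt : OmegaR => (wt.1, (wt.2 + s : lebesgueType R)) : OmegaR).
  apply: measurable_fun_pair => //.
  exact: (measurableT_comp (measurable_Lebesgue_shift s) measurable_snd).
exact: (measurableT_comp mf mG).
Qed.

(** At each time f and X agree off a null set, and one null set serves the countably many times
    [c i]. *)
Lemma modification_law (c : nat -> R) (A : set (@sequence_space R)) :
  measurable A ->
  P [set w | A (fun i => f w (c i))] = P [set w | A (fun i => X (c i) w)].
Proof.
move=> mA; apply: ae_eq_probability.
- have := measurable_fun_sequence (fun i => measurable_fun_section (c i)).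
  by move=> /(_ measurableT A mA); rewrite setTI.
- have : measurable_fun setT ((fun w i => X (c i) w) : Omega -> @sequence_space R).
    by apply: measurable_fun_sequence => i; exact: measurable_funP.
  by move=> /(_ measurableT A mA); rewrite setTI.
- have : {ae P, forall w, forall i, f w (c i) = X (c i) w}.
    by apply/ae_foralln => i; exact: Xf.
  apply: filterS => w fX /=; suff -> : (fun i => f w (c i)) = (fun i => X (c i) w) by [].
  exact/funext.
Qed.

(* By stationarity and Fubini, the probability is the expectation of the measure
   of {s in [0, 1] | f w s in I, f w (s + v k) notin I}. *)
Lemma stationary_cvg_probability (I : set R) (v : nat -> R) (t : R) :
  measurable I -> v @ \oo --> (0 : R) ->
  P [set w | I (X t w) /\ ~ I (X (t + v k) w)] @[k --> \oo] --> 0%E.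
Proof.
move=> mI v0.
(* Coordinate 0 is the reference time, coordinate 1 the time displaced by [v k]. *)
pose c k i : R := if i is 0%N then 0 else v k.
pose C : set (@sequence_space R) := [set y : nat -> R | I (y 0%N) /\ ~ I (y 1%N)].
have mC : measurable C.
  apply: measurableI; [|apply: measurableC];
    by rewrite -[X in measurable X]setTI; exact: measurable_coordinate.
pose q k := P [set w | C (fun i => X (c k i) w)].
have qE s k : P [set w | C (fun i => f w (s + c k i))] = q k.
  by rewrite (modification_law (fun i => s + c k i)) // stationary_sequence_law.
rewrite (_ : (fun k => _) = q); last first.
  apply/funext => k; rewrite /q -(stationary_sequence_law (c k) t)//.
  by rewrite /C /= /c addr0.
pose A k : set OmegaR :=
  [set ws | `[0, 1]%classic ws.2 /\ C (fun i => f ws.1 (ws.2 + c k i))].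
have m01 : measurable (`[0, 1]%classic : set (lebesgueType R)).
  by apply: Borel_Lebesgue; exact: measurable_itv.
have mA k : measurable (A k).
  apply: measurableI.
    by rewrite -[X in measurable X]setTI; exact: measurable_snd.
  have := measurable_fun_sequence (fun i => measurable_fun_shifted (c k i)).
  by move=> /(_ measurableT C mC); rewrite setTI.
have L01 : L `[0%R, 1%R]%classic = 1%E.
  by rewrite -[L _]/(lebesgue_measure _) lebesgue_measure_itv/= lte_fin ltr01 sube0.
(* The section of [A k] at any s in [0, 1] has probability [q k], and [0, 1] has length 1. *)
have qA : q = fun k => (\int[P]_w L (xsection (A k) w))%E.
  apply/funext => k; rewrite fubini_indic//.
  rewrite (eq_integral
    ((cst (q k)) \_ (`[0, 1]%classic : set (lebesgueType R)))); last first.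
    move=> s _; rewrite patchE; case: ifPn => [/set_mem s01|/negP s01].
      rewrite -(qE s k); congr (P _); apply/seteqP; split => w.
        by move=> /ysectionP[].
      by move=> ?; apply/ysectionP.
    rewrite (_ : ysection _ _ = set0) ?measure0//.
    apply/seteqP; split => // w /ysectionP[/= s01' _]; apply: s01.
    by rewrite inE.
  rewrite -integral_mkcond integral_cst//.
  by rewrite -[X in (_ * X)%E]/(L `[0%R, 1%R]%classic) L01 mule1.
rewrite qA.
have [] := @dominated_convergence _ _ _ P setT measurableT
  (fun k w => L (xsection (A k) w)) (cst 0%E) (cst 1%E).
- move=> k.
  exact: (@measurable_fun_xsection _ _ _ _ _ (@completed_lebesgue_measure R)).
- exact: measurable_cst.
- apply/aeW => w _.
  pose M : set (lebesgueType R) := [set s | `[0, 1]%classic s /\ I (f w s)].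
  have mM : measurable M.
    apply: measurableI => //.
    by rewrite -[X in measurable X]setTI; exact: (measurable_fun_pair2 w mf).
  have Moo : (L M < +oo)%E.
    apply: (@le_lt_trans _ _ 1%E); last exact: ltry.
    by rewrite -L01; apply: le_outer_measure => s [].
  (* For fixed w the section lies in M minus a translate of M, which is small once [v k] is close to
     0. *)
  have small e : 0 < e -> \forall k \near \oo, (L (xsection (A k) w) < e%:E)%E.
    move=> e0; have [eta eta0 etaP] := shift_diff_small mM Moo e0.
    have /cvgrPdist_lt /(_ _ eta0) : v @ \oo --> (0 : R) by [].
    apply: filterS => k; rewrite sub0r normrN => /etaP; apply: le_lt_trans.
    apply: le_outer_measure => s /xsectionP[/= s01 [Is Iv]]; split.
      by split => //; rewrite addr0 in Is.
    by case.
  apply/fine_cvgP; split.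
    apply: filterS (small 1 ltr01) => k Lk.
    by rewrite ge0_fin_numE ?outer_measure_ge0// (lt_trans Lk)// ltry.
  apply/cvgrPdist_lt => e e0; apply: filterS (small e e0) => k Lk.
  rewrite sub0r normrN ger0_norm ?fine_ge0 ?outer_measure_ge0//.
  rewrite -lte_fin fineK// ge0_fin_numE ?outer_measure_ge0// (lt_trans Lk)// ltry//.
- by apply: finite_measure_integrable_cst.
- apply/aeW => w k _; rewrite gee0_abs ?outer_measure_ge0// -L01.
  by apply: le_outer_measure => s /xsectionP[].
by move=> _ _; rewrite integral0.
Qed.

End joint_measurability.

(** * Images in standard probability spaces *)

Section lebesgue_lusin.
Context {R : realType}.
Local Notation L := (lebesgue_outer R).

Lemma Lebesgue_null_measurable (N : set R) :
  L N = 0%E -> measurable (N : set (lebesgueType R)).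
Proof.
move=> N0; apply: negligible_sub_caratheodory.
have [A [mA A0 NA]] := (negligible_outer_measure N).2 N0.
by exists A; split => //; exact: Borel_Lebesgue.
Qed.

(* The library's Lusin theorem is for Borel functions on Borel sets: one first
   discards the null set where the sets {g > q}, q rational, are not Borel. *)
Lemma Lebesgue_lusin (M : set R) (g : R -> R) (e : R) :
  measurable (M : set (lebesgueType R)) -> (L M < +oo)%E ->
  (forall q : rat, measurable (M `&` [set t | ratr q < g t] : set (lebesgueType R))) ->
  0 < e ->
  exists K, [/\ compact K, K `<=` M, (L (M `\` K) < e%:E)%E &
    {within K, continuous g}].
Proof.
move=> mM Moo mg e0.
have [B BP] := choice (fun q => Lebesgue_measurable_Borel (mg q)).
(* N gathers what the Borel subsets [B q] miss; it is a countable union of null sets. *)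
pose N := \bigcup_q ((M `&` [set t | ratr q < g t]) `\` B q).
have N0 : L N = 0%E.
  apply/negligible_outer_measure.
  rewrite (_ : N = \bigcup_i odflt set0 (omap (fun q =>
    (M `&` [set t | ratr q < g t]) `\` B q) (unpickle i))).
    apply: negligible_bigcup => i; case: unpickle => [q|] /=; last exact: negligible_set0.
    by apply/negligible_outer_measure; have [] := BP q.
  apply/seteqP; split => t.
    move=> [q _ Nqt]; exists (pickle q); [exact: I|rewrite pickleK; exact: Nqt].
  by move=> [i _]; case: unpickle => [q|//] Nqt; exists q.
have [|D [mD DMN MND]] := @Lebesgue_measurable_Borel _ (M `\` N).
  by apply: measurableD => //; exact: Lebesgue_null_measurable.
have Doo : (L D < +oo)%E.
  by apply: le_lt_trans Moo; apply: le_outer_measure => t /DMN[].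
have mgD : measurable_fun D g.
  move=> _; apply: (measurability _ (RGenOInfty.measurableE R)) => //.
  move=> /= _ [_ [a ->] <-]; rewrite preimage_itvoy.
  (* Since D avoids N, the part of D where g exceeds a is covered by the Borel sets [B q] with q >
     a. *)
  rewrite (_ : _ `&` _ = \bigcup_(q : rat)
      (D `&` (if a < ratr q then B q else set0))); last first.
    apply/seteqP; split => [t [Dt /= agt]|t [q _ [Dt]]].
      have [q /andP[aq qg]] : exists q : rat, a < ratr q < g t.
        by have [q] := rat_in_itvoo agt; rewrite in_itv /=; exists q.
      exists q => //; split => //; rewrite aq; apply: contrapT => nB.
      by have [Mt []] := DMN _ Dt; exists q.
    case: ifPn => // aq Bqt; split => //=.
    by have [_ BM _] := BP q; have [_ /(lt_trans aq)] := BM _ Bqt.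
  apply: bigcupT_measurable_rat => q; apply: measurableI => //.
  by case: ifPn => // _; have [] := BP q.
have [K [cK KD DK gK]] := measurable_almost_continuous mD Doo e0 mgD.
exists K; split => //; first by move=> t /KD /DMN[].
apply: le_lt_trans DK.
rewrite -[leRHS]add0e -MND -[leRHS]add0e -N0.
apply: le_trans; last by apply: leeD2l; exact: outer_measureU2.
apply: le_trans (outer_measureU2 _ _ _); apply: le_outer_measure => t [Mt Kt].
have [Nt|Nt] := pselect (N t); first by left.
by right; have [Dt|Dt] := pselect (D t); [right|left].
Qed.

End lebesgue_lusin.

Section standard.
Context {R : realType} d {Omega : measurableType d} (P : probability Omega R).
Local Notation L := (lebesgue_outer R).

(* B need not be measurable. On the interval model, Lusin's theorem makes Y
   continuous on compact sets of almost full measure, whose images are compact,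
   hence Borel; the image of a general measurable set would only be analytic. *)
Lemma standard_image (Y : Omega -> R) (B : set R) :
  standard_probability P -> measurable_fun setT Y -> {ae P, forall w, B (Y w)} ->
  exists B', [/\ measurable B', B' `<=` B & P (Y @^-1` B') = 1%E].
Proof.
move=> [_ [a [p [a0 p0 [phi [A0 [B0 [[mA0 PA0] [mB0 _] bij mphi Pphi]]]]]]]] mY.
move=> [N [mN N0 BN]].
have {}BN w : ~ N w -> B (Y w) by move=> nN; apply: contrapT => /BN.
have [phiA0B0 phi_inj _] := bij.
pose E := A0 `\` N.
have mE : measurable E by exact: measurableD.
have EA0 : E `<=` A0 by move=> w [].
have PE : P E = 1%E.
  have : P (~` E) = 0%E.
    apply/eqP; rewrite -measure_le0 setCD -[leRHS]adde0 -{1}PA0 -N0.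
    by rewrite measureU2//; exact: measurableC.
  by rewrite -{2}[E]setCK (probability_setC P (measurableC mE)) => ->; rewrite sube0.
pose nu := @interval_atoms R a p.
have nuE : nu (phi @` E) = 1%E by rewrite -PE Pphi.
(* [psi] inverts the isomorphism on its domain, so that [g] below is Y read on the interval
   model. *)
have [psi psiP] : exists psi : R -> Omega, forall w, A0 w -> psi (phi w) = w.
  exists (fun s => xget point [set w | A0 w /\ phi w = s]) => w Aw.
  case: xgetP => [w' _ [Aw' ww']|/(_ w)]; last by case.
  by apply: phi_inj => //; rewrite inE.
pose g s := Y (psi s).
pose F : set R := phi @` E `&` `[0, a]%classic.
have mF V : measurable V -> measurable (F `&` g @^-1` V : set (lebesgueType R)).
  move=> mV; rewrite (_ : _ `&` _ = phi @` (E `&` Y @^-1` V) `&` `[0, a]%classic).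
    apply: measurableI; last by apply: Borel_Lebesgue; exact: measurable_itv.
    apply/mphi; first by move=> w [/EA0].
    by apply: measurableI => //; rewrite -[X in measurable X]setTI; exact: mY.
  apply/seteqP; split.
    move=> _ [[[w Ew <-] ?]]; rewrite /g /= psiP; last exact: EA0.
    by move=> Vw; split => //; exists w.
  move=> _ [[w [Ew Vw] <-] ?]; split; first by split => //; exists w.
  by rewrite /g /= psiP//; exact: EA0.
have mF' : measurable (F : set (lebesgueType R)).
  by have := mF _ measurableT; rewrite preimage_setT setIT.
have Foo : (L F < +oo)%E.
  apply: (@le_lt_trans _ _ (L `[0%R, a]%classic)).
    by apply: le_outer_measure; exact: subIsetr.
  by rewrite -[L _]/(lebesgue_measure _) lebesgue_measure_itv/=; case: ifP; rewrite ?ltry.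
have lusin m : exists K, [/\ compact K, K `<=` F, (L (F `\` K) < (m.+1%:R^-1)%:E)%E &
    {within K, continuous g}].
  apply: Lebesgue_lusin => // q; rewrite -preimage_itvoy; apply: mF.
  exact: measurable_itv.
have [K KP] := choice lusin.
pose at_ n : R := - n.+1%:R.
(* The compact sets [K m] exhaust the continuous part up to a null set; the atom positions in the
   image of E are added one by one. *)
pose Z : set R := \bigcup_m K m `|` \bigcup_n (phi @` E `&` [set at_ n]).
have mK m : measurable (K m : set (lebesgueType R)).
  have [cK _ _ _] := KP m; apply: Borel_Lebesgue; exact: compact_measurable.
have mat n : measurable (phi @` E `&` [set at_ n] : set (lebesgueType R)).
  apply: measurableI; first exact/mphi.
  by apply/Borel_Lebesgue; exact: measurable_set1.
have mZ : measurable (Z : set (lebesgueType R)).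
  by apply: measurableU; apply: bigcupT_measurable.
have ZE : Z `<=` phi @` E.
  by move=> s [[m _]|[m _ []//]]; have [_ KF _ _] := KP m; move=> /KF[].
have nuZ : nu Z = nu (phi @` E).
  rewrite /nu /interval_atoms; congr (_ + _)%E.
    apply/eqP; rewrite eq_le; apply/andP; split.
      by apply: le_outer_measure; exact: setSI.
    apply: (@le_trans _ _ (L (Z `&` `[0%R, a]%classic) + L (F `\` Z))%E).
      apply: le_trans (outer_measureU2 _ _ _); apply: le_outer_measure => s [Es sa].
      by have [Zs|Zs] := pselect (Z s); [left|right].
    suff -> : L (F `\` Z) = 0%E by rewrite adde0.
    apply/eqP; rewrite eq_le outer_measure_ge0 andbT.
    apply/lee_addgt0Pr => e e0; rewrite add0e.
    have [m me] := natSinv_lt e0.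
    have [_ _ FK _] := KP m; apply: (@le_trans _ _ (m.+1%:R^-1)%:E); last first.
      by rewrite lee_fin ltW.
    apply: ltW; apply: le_lt_trans FK; apply: le_outer_measure => s [Fs Zs].
    by split => // Ks; apply: Zs; left; exists m.
  apply: eq_eseriesr => n _; congr (_ * _)%E; rewrite !diracE; congr (_%:R%:E).
  congr (nat_of_bool _); apply/idP/idP; rewrite !inE; first exact: ZE.
  by move=> En; right; exists n.
pose S := A0 `&` phi @^-1` Z.
have phiS : phi @` S = Z.
  apply/seteqP; split => [_ [w [_ Zw] <-]//|s Zs].
  by have [w [Aw Nw] ws] := ZE _ Zs; exists w => //; split => //=; rewrite ws.
have mS : measurable S by apply/mphi; [move=> w []|rewrite phiS].
have PS : P S = 1%E.
  rewrite Pphi //; last by move=> w [].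
  by rewrite phiS -[interval_atoms _ _ _]/(nu Z) nuZ.
(* [g] sends each [K m] to a compact set and each atom to a point. *)
have mB' : measurable (g @` Z).
  rewrite image_setU !image_bigcup; apply: measurableU; apply: bigcupT_measurable => m.
    by apply: compact_measurable; apply: continuous_compact; have [] := KP m.
  have [h|h] := pselect ((phi @` E) (at_ m)).
    by rewrite (_ : _ `&` _ = [set at_ m]) ?image_set1//; apply/setIidr => _ ->.
  rewrite (_ : _ `&` _ = set0) ?image_set0//.
  by apply/seteqP; split => // t [Et tm]; apply: h; rewrite -tm.
have mYB' : measurable (Y @^-1` (g @` Z)).
  by rewrite -[X in measurable X]setTI; exact: mY.
exists (g @` Z); split => //.
  by move=> _ [s Zs <-]; have [w [Aw Nw] <-] := ZE _ Zs; rewrite /g psiP//; exact: BN.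
apply/eqP; rewrite eq_le probability_le1//= -PS; apply: le_measure; rewrite ?inE//.
move=> w [Aw Zw] /=; exists (phi w) => //; rewrite /g psiP//.
Qed.

End standard.

(** * Almost sure properties transferred to random shifts *)

Section code.
Context {R : realType}.
Implicit Types b : nat -> bool.

Definition ternary_sum b N : R := \sum_(0 <= n < N) (b n)%:R / 3 ^+ n.

(* An injection of {0,1}^N into R, since standard_image is about real-valued
   maps; base 3 avoids the double expansions of base 2. *)
Definition ternary b : R := limn (ternary_sum b).

Lemma ternary_sumS b N : ternary_sum b N.+1 = ternary_sum b N + (b N)%:R / 3 ^+ N.
Proof. by rewrite /ternary_sum big_nat_recr. Qed.

(** The last term is the sum of 1/3^n for n from m to m + k - 1, that is, the tail with all digits
    equal to 1. *)
Lemma ternary_sum_tail b m k :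
  ternary_sum b (m + k) <= ternary_sum b m + 3 / 2 / 3 ^+ m * (1 - (3 ^+ k)^-1).
Proof.
have p0 j : 0 < (3 ^+ j : R)^-1 by rewrite invr_gt0 exprn_gt0.
elim: k => [|k IH]; first by rewrite addn0 expr0 invr1 subrr mulr0 addr0.
rewrite addnS ternary_sumS exprD exprS !invfM.
have : (b (m + k)%N)%:R * ((3 ^+ m)^-1 * (3 ^+ k)^-1) <= (3 ^+ m)^-1 * (3 ^+ k)^-1 :> R.
  apply: ler_piMl; first by rewrite mulr_ge0// ltW.
  by case: (b _).
by move: IH; lra.
Qed.

Lemma ternary_sum_homo b : {homo ternary_sum b : m n / (m <= n)%N >-> m <= n}.
Proof.
apply: homo_leq => [x|y x z|n]; [exact: lexx|exact: le_trans|].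
by rewrite ternary_sumS lerDl divr_ge0// exprn_ge0.
Qed.

Lemma ternary_cvg b : ternary_sum b @ \oo --> ternary b.
Proof.
apply: nondecreasing_is_cvgn; first exact: ternary_sum_homo.
exists (3 / 2) => _ [N _ <-].
have := ternary_sum_tail b 0 N; rewrite add0n /ternary_sum big_nil expr0 invr1 add0r.
have : 0 < (3 ^+ N : R)^-1 by rewrite invr_gt0 exprn_gt0.
lra.
Qed.

(** The digit at m adds 1/3^m for b, while all later digits of b' together add at most half of
    that. *)
Lemma ternary_lt b b' m : (forall n, (n < m)%N -> b n = b' n) ->
  b' m = false -> b m = true -> ternary b' < ternary b.
Proof.
move=> bb' b'm bm.
have p0 : 0 < (3 ^+ m : R)^-1 by rewrite invr_gt0 exprn_gt0.
have E : ternary_sum b m = ternary_sum b' m.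
  by apply: eq_big_nat => n /andP[_ nm]; rewrite bb'.
have : ternary_sum b m + (3 ^+ m)^-1 <= ternary b.
  apply: limr_ge; first exact/cvgP/ternary_cvg.
  exists m.+1 => // n /= mn; apply: le_trans (ternary_sum_homo _ mn).
  by rewrite ternary_sumS bm mul1r.
have : ternary b' <= ternary_sum b' m + 1 / 2 / 3 ^+ m.
  apply: limr_le; first exact/cvgP/ternary_cvg.
  exists m.+1 => // n /= mn; rewrite -(subnKC mn).
  apply: le_trans (ternary_sum_tail _ _ _) _.
  rewrite ternary_sumS b'm mul0r addr0 exprS invfM.
  have : 0 < (3 ^+ (n - m.+1) : R)^-1 by rewrite invr_gt0 exprn_gt0.
  by nra.
rewrite E; lra.
Qed.

Lemma ternary_inj b b' : ternary b = ternary b' -> b = b'.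
Proof.
move=> bb'; apply: contrapT => nbb'.
have : exists n, b n != b' n.
  apply: contrapT => /forallNP h; apply: nbb'; apply/funext => n.
  by apply/eqP/negPn/negP/h.
move=> /ex_minnP[m bm min_m].
have lt_m n : (n < m)%N -> b n = b' n.
  by move=> nm; apply/eqP; apply: contraLR nm => /min_m; rewrite leqNgt.
case Eb : (b m); case Eb' : (b' m); rewrite Eb Eb' // in bm.
  by have := ternary_lt lt_m Eb' Eb; rewrite bb' ltxx.
have := @ternary_lt b' b m (fun n nm => esym (lt_m n nm)) Eb Eb'.
by rewrite bb' ltxx.
Qed.

Lemma measurable_ternary d (T : measurableType d) (O : nat -> set T) :
  (forall n, measurable (O n)) ->
  measurable_fun setT (fun y => ternary (fun n => y \in O n)).
Proof.
move=> mO; apply: (@measurable_fun_cvg _ _ _ setT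
  (fun N y => ternary_sum (fun n => y \in O n) N)); last first.
  by move=> y _; exact: ternary_cvg.
move=> N; rewrite /ternary_sum.
apply: measurable_sum => n.
apply: measurable_funM => //.
exact: (measurable_indic (mO n)).
Qed.

End code.

Section shift.
Context {R : realType} d {Omega : measurableType d} (P : probability Omega R).
Local Notation L := (lebesgue_outer R).
Local Notation OmegaR := (Omega * lebesgueType R)%type.
Context (X : R -> {RV P >-> R}) (f : Omega -> R -> R).
Hypotheses (HP : standard_probability P) (Xf : modification X f)
  (mf : measurable_fun [set: OmegaR] (fun wt : OmegaR => f wt.1 wt.2))
  (statX : stationary X).

(** G is an arbitrary set of bit sequences. Once these are coded as reals, [standard_image] puts a
    Borel set B of full probability inside the codes of G. Missing B is then a measurable event,
    null at every shift h by stationarity, and Fubini exchanges w and h. *)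
Lemma ae_shift (O : nat -> set (@sequence_space R)) (c : nat -> R)
    (G : set (nat -> bool)) :
  (forall n, measurable (O n)) ->
  {ae P, forall w, G (fun n => (fun i => X (c i) w) \in O n)} ->
  {ae P, forall w, L [set h | ~ G (fun n => (fun i => f w (h + c i)) \in O n)] = 0%E}.
Proof.
move=> mO GX.
pose code (y : @sequence_space R) : R := ternary (fun n => y \in O n).
have mcode : measurable_fun setT code by exact: measurable_ternary.
have mXc : measurable_fun setT ((fun w i => X (c i) w) : Omega -> @sequence_space R).
  by apply: measurable_fun_sequence => i; exact: measurable_funP.
have [||B [mB BG PB]] := @standard_image _ _ _ P (fun w => code (fun i => X (c i) w))
    (ternary @` G) HP.
- exact: (measurableT_comp mcode mXc).
- by apply: filterS GX => w Gw; exists (fun n => (fun i => X (c i) w) \in O n).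
pose C : set (@sequence_space R) := ~` (code @^-1` B).
have mC : measurable C.
  by apply: measurableC; rewrite -[X in measurable X]setTI; exact: mcode.
pose A : set OmegaR := [set wh | C (fun i => f wh.1 (wh.2 + c i))].
have mA : measurable A.
  have := measurable_fun_sequence (fun i => measurable_fun_shifted mf (c i)).
  by move=> /(_ measurableT C mC); rewrite setTI.
have : forall h, P (ysection A h) = 0%E.
  move=> h; rewrite (_ : ysection A h = [set w | C (fun i => f w (h + c i))]); last first.
    by apply/seteqP; split => w; [move=> /ysectionP|move=> Cw; apply/ysectionP].
  rewrite (modification_law Xf mf (fun i => h + c i) mC) stationary_sequence_law//.
  rewrite -[[set w | _]]/(~` ((fun w => code (fun i => X (c i) w)) @^-1` B)).
  rewrite probability_setC ?PB ?subee//.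
  by rewrite -[X in measurable X]setTI; exact: (measurableT_comp mcode mXc).
move=> /(ae_negligible_xsection mA); apply: filterS => w LA0.
apply/eqP; rewrite eq_le outer_measure_ge0 andbT -LA0.
apply: le_outer_measure => h nG; apply/xsectionP => /= Bh; apply: nG.
by have [b Gb /ternary_inj <-] := BG _ Bh.
Qed.

End shift.

(** * Oscillation on closures *)

Section oscillation.
Context {R : realType}.

Lemma ae_forall_countable d (T : measurableType d) (mu : {measure set T -> \bar R})
    (I : countType) (Q : I -> T -> Prop) :
  (forall i, {ae mu, forall w, Q i w}) -> {ae mu, forall w, forall i, Q i w}.
Proof.
move=> aeQ; pose Q' n w := if unpickle n is Some i then Q i w else True.
have : {ae mu, forall w, forall n, Q' n w}.
  apply/ae_foralln => n; rewrite /Q'; case: unpickle => [i|]; first exact: aeQ.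
  exact/aeW.
apply: filterS => w Qw i; have := Qw (pickle i).
by rewrite /Q' pickleK.
Qed.

(** S will be the set of indices i with [c i] in a given set of times; only countably many
    constraints arise. *)
Definition osc_set (S : set nat) (e : R) : set (@sequence_space R) :=
  [set y : nat -> R | forall i j, S i -> S j -> `|y i - y j| <= e].

Lemma measurable_osc_set S e : measurable (osc_set S e).
Proof.
rewrite (_ : osc_set S e = \bigcap_i \bigcap_j
  [set y : sequence_space |
    S i -> S j -> `|(y : nat -> R) i - (y : nat -> R) j| <= e]); last first.
  apply/seteqP; split => y ye; first by move=> i _ j _; exact: ye.
  by move=> i j; exact: ye.
apply: bigcapT_measurable => i; apply: bigcapT_measurable => j.
have [Sij|nSij] := pselect (S i /\ S j); last first.
  rewrite (_ : mkset _ = setT); first exact: measurableT.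
  by apply/seteqP; split => // y _ Si Sj; case: nSij.
rewrite (_ : mkset _ = (fun y : @sequence_space R => (y : nat -> R) i - (y : nat -> R) j)
  @^-1` `[- e, e]%classic).
  rewrite -[X in measurable X]setTI.
  apply: (@measurable_funB _ _ R setT (fun y : @sequence_space R => (y : nat -> R) i)
    (fun y : @sequence_space R => (y : nat -> R) j)) => //;
    exact: measurable_coordinate.
case: Sij => Si Sj; apply/seteqP; split => y /=; rewrite in_itv /= -ler_norml.
  exact.
by [].
Qed.

Lemma closure_sequence (S : set nat) (c : nat -> R) (z : R) :
  closure (c @` S) z ->
  exists2 i_ : nat -> nat, (forall k, S (i_ k)) & c (i_ k) @[k --> \oo] --> z.
Proof.
move=> cz.
have h k : exists i, S i /\ `|z - c i| < k.+1%:R^-1.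
  have [|_ [[i Si <-] ?]] := cz (ball z k.+1%:R^-1).
    by apply: nbhsx_ballx; rewrite invr_gt0.
  by exists i.
have [i_ iP] := choice h.
exists i_; first by move=> k; have [] := iP k.
apply/cvgrPdist_lt => e e0; near=> k.
have [_ /lt_trans] := iP k; apply.
by near: k; exact: (near_infty_natSinv_lt (PosNum e0)).
Unshelve. all: by end_near. Qed.

Context d {Omega : measurableType d} (P : probability Omega R).
Local Notation OmegaR := (Omega * lebesgueType R)%type.
Context (X : R -> {RV P >-> R}) (f : Omega -> R -> R).
Hypotheses (Xf : modification X f)
  (mf : measurable_fun [set: OmegaR] (fun wt : OmegaR => f wt.1 wt.2))
  (statX : stationary X).

(** Times [h + c i] with i in S approach y and y', and continuity in probability passes the bound to
    the limit. *)
Lemma osc_closure (S : set nat) (c : nat -> R) (e h y y' : R) :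
  closure (c @` S) (y - h) -> closure (c @` S) (y' - h) ->
  {ae P, forall w, osc_set S e (fun i => X (h + c i) w) -> X y w - X y' w <= e}.
Proof.
move=> /closure_sequence[i_ Si ci] /closure_sequence[j_ Sj cj].
pose E : set Omega := [set w | osc_set S e (fun i => X (h + c i) w)].
have mE : measurable E.
  have : measurable_fun setT ((fun w i => X (h + c i) w) : Omega -> @sequence_space R).
    by apply: measurable_fun_sequence => i; exact: measurable_funP.
  by move=> /(_ measurableT _ (measurable_osc_set S e)); rewrite setTI.
(* A violation leaves room for a rational q between [X y' w + e] and [X y w], so each q may be
   treated separately. *)
suff : {ae P, forall w, forall q : rat, ~ (E w /\ ratr q < X y w /\ X y' w < ratr q - e)}.
  apply: filterS => w bad Ew; rewrite leNgt; apply/negP => eXX.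
  have /rat_in_itvoo[q] : X y' w + e < X y w by lra.
  by rewrite in_itv /= => /andP[? ?]; apply: (bad q); split => //; split => //; lra.
apply: ae_forall_countable => q.
pose I : set R := `]ratr q, +oo[%classic; pose J : set R := `]-oo, ratr q - e[%classic.
have mI : measurable I by exact: measurable_itv.
have mJ : measurable J by exact: measurable_itv.
have v0 (z : R) (k_ : nat -> nat) : c (k_ k) @[k --> \oo] --> z - h ->
    (h + c (k_ k) - z) @[k --> \oo] --> (0 : R).
  move=> ck; rewrite (_ : 0 = h + (z - h) - z); last by ring.
  by apply: cvgB; [apply: cvgD => //; exact: cvg_cst|exact: cvg_cst].
have a0 := stationary_cvg_probability Xf mf statX y mI (v0 _ _ ci).
have b0 := stationary_cvg_probability Xf mf statX y' mJ (v0 _ _ cj).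
pose bad := [set w | E w /\ ratr q < X y w /\ X y' w < ratr q - e].
have mXI (K : set R) t : measurable K -> measurable (X t @^-1` K).
  by move=> mK; rewrite -[X in measurable X]setTI; exact: measurable_funP.
have mbad : measurable bad.
  rewrite (_ : bad = E `&` (X y @^-1` I `&` X y' @^-1` J)).
    by apply: measurableI => //; apply: measurableI; exact: mXI.
  by apply/seteqP; split => w; rewrite /bad /I /J /= !in_itv/= andbT.
suff bad0 : P bad = 0%E by exists bad; split => // w /=; rewrite notK.
apply/eqP; rewrite -measure_le0.
have := cvgeD _ a0 b0; rewrite adde0 => /(_ _ isT) ab0.
apply: (cvge_to_ge ab0); apply: nearW => k /=.
have mdiff (K : set R) t t' : measurable K ->
    measurable [set w | K (X t w) /\ ~ K (X t' w)].
  by move=> mK; apply: measurableI; [|apply: measurableC]; exact: mXI.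
apply: le_trans (measureU2 _ (mdiff I y _ mI) (mdiff J y' _ mJ)).
apply: le_measure; rewrite ?inE//.
  by apply: measurableU; exact: mdiff.
move=> w [Ew [qX Xq]].
have shiftE (z t : R) : z + (t - z) = t by ring.
rewrite /setU /= !shiftE.
(* If both approximating values kept to the sides I and J of the limit values, they would differ by
   more than e. *)
have [II|nI] := pselect (I (X (h + c (i_ k)) w)); last first.
  by left; split => //; rewrite /I /= in_itv /= andbT.
right; split; first by rewrite /J /= in_itv.
have := Ew _ _ (Si k) (Sj k); move: II.
rewrite /I /J /= !in_itv /= andbT ler_norml => qXi /andP[_ XX] Xjq.
by lra.
Qed.

End oscillation.

(** For all n, q and k, a point of [U n] within 1/(k+1) of q is picked if there is one. A single
    sequence serves every n, each n keeping the indices that fall in [U n]. *)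
Lemma dense_sequence {R : realType} (U : nat -> set R) :
  exists c : nat -> R, forall n, U n `<=` closure (c @` [set i | U n (c i)]).
Proof.
pose near_set (nqk : nat * rat * nat) : set R :=
  [set z | U nqk.1.1 z /\ `|ratr nqk.1.2 - z| < nqk.2.+1%:R^-1].
pose c i : R := if unpickle i is Some nqk then xget 0 (near_set nqk) else 0.
exists c => n z Uz V /nbhs_ballP[r /= r0 rV].
have r20 : 0 < r / 2 by rewrite divr_gt0.
have [k kr] := natSinv_lt r20.
have k0 : 0 < k.+1%:R^-1 :> R by rewrite invr_gt0.
have /rat_in_itvoo[q] : z - k.+1%:R^-1 < z + k.+1%:R^-1.
  by rewrite ltrD2l gtrN.
rewrite in_itv /= => /andP[zq qz].
have qzk : `|ratr q - z| < k.+1%:R^-1 by rewrite ltr_distl zq qz.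
have cE : c (pickle (n, q, k)) = xget 0 (near_set (n, q, k)).
  by rewrite /c pickleK.
have [Uc cq] : near_set (n, q, k) (c (pickle (n, q, k))).
  by rewrite cE; apply: xgetPex; exists z.
exists (c (pickle (n, q, k))); split; first by exists (pickle (n, q, k)).
apply: rV; rewrite /ball /= -(subrK (ratr q) z) -addrA.
apply: le_lt_trans (ler_normD _ _) _; rewrite distrC.
by rewrite [r]splitr ltrD// (lt_trans _ kr).
Qed.

(** * Small oscillation near every real point *)

Section modulus.
Context {R : realType} d {Omega : measurableType d} (P : probability Omega R).
Local Notation L := (lebesgue_outer R).
Local Notation OmegaR := (Omega * lebesgueType R)%type.
Context (X : R -> {RV P >-> R}) (f : Omega -> R -> R).
Hypotheses (HP : standard_probability P) (Xf : modification X f)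
  (mf : measurable_fun [set: OmegaR] (fun wt : OmegaR => f wt.1 wt.2))
  (statX : stationary X).

Lemma osc_closure_norm (S : set nat) (c : nat -> R) (e h y y' : R) :
  closure (c @` S) (y - h) -> closure (c @` S) (y' - h) ->
  {ae P, forall w, osc_set S e (fun i => f w (h + c i)) -> `|f w y - f w y'| <= e}.
Proof.
move=> cy cy'.
have aeX : {ae P, forall w, forall i, f w (h + c i) = X (h + c i) w}.
  by apply/ae_foralln => i; exact: Xf.
have h1 := osc_closure Xf mf statX e cy cy'.
have h2 := osc_closure Xf mf statX e cy' cy.
near=> w => osc.
have fX : (fun i => f w (h + c i)) = (fun i => X (h + c i) w).
  by apply/funext; near: w; exact: aeX.
have -> : f w y = X y w by near: w; exact: Xf.
have -> : f w y' = X y' w by near: w; exact: Xf.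
rewrite fX in osc; rewrite ler_norml.
have : X y w - X y' w <= e by move: osc; near: w; exact: h1.
have : X y' w - X y w <= e by move: osc; near: w; exact: h2.
lra.
Unshelve. all: by end_near. Qed.

(** The exceptional null set is fixed before x: it involves only n and pairs of times from the
    sequence D. The point x enters afterwards, through the sets [M n]. *)
Lemma ae_osc_small (T : set R) (U : nat -> set R) (c D : nat -> R) (e : R) :
  non_null T ->
  (forall n, U n `<=` closure (c @` [set i | U n (c i)])) ->
  {ae P, forall w, forall t, T t ->
    exists n, U n t /\ osc_set [set i | U n (c i)] e (fun i => X (c i) w)} ->
  {ae P, forall w, forall x, exists2 eta, 0 < eta & forall i j,
    `|x - D i| < eta -> `|x - D j| < eta -> `|f w (D i) - f w (D j)| <= e}.
Proof.
move=> T0 cU TU.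
pose S n : set nat := [set i | U n (c i)].
(* U n is arbitrary, but F n is closed, which makes M n below measurable. *)
pose F n : set R := closure (c @` S n).
pose G (b : nat -> bool) := forall t, T t -> exists n, U n t /\ b n.
have good : {ae P, forall w, L [set h | ~ G (fun n =>
    (fun i => f w (h + c i)) \in osc_set (S n) e)] = 0%E}.
  apply: (ae_shift HP Xf mf statX); first by move=> n; exact: measurable_osc_set.
  by apply: filterS TU => w TU t /TU[n [Un On]]; exists n; split => //; rewrite inE.
have mFx n (y : R) : measurable ([set h | F n (y - h)] : set (lebesgueType R)).
  have mF : measurable (F n : set (lebesgueType R)).
    by apply: Borel_Lebesgue; apply: closed_measurable; exact: closed_closure.
  by have := measurable_Lebesgue_reflect y measurableT mF; rewrite setTI.
have mO n : measurable [set wh : OmegaR | osc_set (S n) e (fun i => f wh.1 (wh.2 + c i))].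
  have := measurable_fun_sequence (fun i => measurable_fun_shifted mf (c i)).
  by move=> /(_ measurableT _ (measurable_osc_set (S n) e)); rewrite setTI.
(* [A (n, i, j)] holds the pairs (w, h) that violate [osc_closure_norm] at the times [D i] and
   [D j]. *)
pose A (nij : nat * nat * nat) : set OmegaR := [set wh |
  osc_set (S nij.1.1) e (fun i => f wh.1 (wh.2 + c i)) /\
  (F nij.1.1 (D nij.1.2 - wh.2) /\ F nij.1.1 (D nij.2 - wh.2)) /\
  e < `|f wh.1 (D nij.1.2) - f wh.1 (D nij.2)|].
have mA nij : measurable (A nij).
  apply: measurableI; first exact: mO.
  have msnd (B : set (lebesgueType R)) : measurable B ->
      measurable [set wh : OmegaR | B wh.2].
    move=> mB.
    have := @measurable_snd _ _ Omega (lebesgueType R) measurableT _ mB.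
    by rewrite setTI.
  apply: measurableI; first exact: (measurableI _ _
    (msnd _ (mFx nij.1.1 (D nij.1.2))) (msnd _ (mFx nij.1.1 (D nij.2)))).
  have mft t : measurable_fun [set: OmegaR] (fun wh : OmegaR => f wh.1 t).
    exact: (measurableT_comp (measurable_fun_section mf t) measurable_fst).
  have mdist := measurableT_comp (@normr_measurable R setT)
    (measurable_funB (mft (D nij.1.2)) (mft (D nij.2))).
  have := mdist measurableT `]e, +oo[%classic (measurable_itv _).
  rewrite setTI preimage_itvoy; exact.
have bad : {ae P, forall w, forall nij, L (xsection (A nij) w) = 0%E}.
  apply: ae_forall_countable => nij; apply: ae_negligible_xsection => // h.
  have [[Fi Fj]|nF] := pselect (F nij.1.1 (D nij.1.2 - h) /\ F nij.1.1 (D nij.2 - h)).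
    apply/negligibleP; first exact: measurable_ysection.
    apply: negligibleS (osc_closure_norm e Fi Fj) => w /ysectionP[/= osc [_ lt_e]].
    by move=> /(_ osc); rewrite leNgt lt_e.
  rewrite (_ : ysection _ _ = set0) ?measure0//.
  by apply/seteqP; split => // w /ysectionP[_ [FF _]].
near=> w => x.
have Gw : L [set h | ~ G (fun n => (fun i => f w (h + c i)) \in osc_set (S n) e)] = 0%E.
  by near: w; exact: good.
have Aw nij : L (xsection (A nij) w) = 0%E by move: nij; near: w; exact: bad.
pose M n : set R := [set h | osc_set (S n) e (fun i => f w (h + c i)) /\ F n (x - h)].
have mM n : measurable (M n : set (lebesgueType R)).
  apply: measurableI; last exact: mFx.
  have := measurable_xsection w (mO n).
  rewrite (_ : xsection _ _ = [set h | osc_set (S n) e (fun i => f w (h + c i))])//.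
  by apply/seteqP; split => h; [move=> /xsectionP|move=> ?; apply/xsectionP].
(* Otherwise x - T, which is non-null, would be covered by the null sets [M n] and the null set of
   exceptional shifts. *)
have [n Mn] : exists n, (0 < L (M n))%E.
  apply: contrapT => /forallNP M0.
  move: T0; rewrite /non_null -(outer_reflect x) ltNge => /negP; apply.
  have ML : L (\bigcup_n M n) = 0%E.
    apply/eqP; rewrite eq_le outer_measure_ge0 andbT.
    apply: le_trans (outer_measure_sigma_subadditive _ _) _.
    rewrite eseries0// => n _ _; apply/eqP; rewrite eq_le outer_measure_ge0 andbT leNgt.
    by apply/negP; exact: M0.
  rewrite -[leRHS]adde0 -{1}Gw -ML.
  apply: le_trans (outer_measureU2 _ _ _); apply: le_outer_measure => h Th.
  have [Gh|Gh] := pselect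
    (G (fun n => (fun i => f w (h + c i)) \in osc_set (S n) e)); last by left.
  right; have [n [Un /set_mem On]] := Gh _ Th.
  by exists n => //; split => //; exact: cU.
have [eta eta0 etaP] := steinhaus3 (mM n) Mn.
exists eta => // i j xi xj; rewrite leNgt; apply/negP => lt_e.
have := etaP _ _ xi xj; rewrite ltNge => /negP; apply.
(* Moving h by [x - D i] turns the condition on x - h into one on [D i - h], so the triple
   intersection lies in a null section. *)
rewrite -(Aw (n, i, j)); apply: le_outer_measure => h [[[On _] [_ Fi]] [_ Fj]].
have shiftE z : x - (h + (x - z)) = z - h by ring.
apply/xsectionP; split => //=; split => //; split.
  by move: Fi; rewrite /= shiftE.
by move: Fj; rewrite /= shiftE.
Unshelve. all: by end_near. Qed.

End modulus.

(** * Continuous extension *)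

Lemma rational_near {R : realType} (x eta : R) : 0 < eta ->
  exists q : rat, `|x - ratr q| < eta.
Proof.
move=> eta0; have /rat_in_itvoo[q] : x - eta < x + eta by rewrite ltrD2l gtrN.
by rewrite in_itv /= => /andP[xq qx]; exists q; rewrite distrC ltr_distl xq qx.
Qed.

(** Values at rationals tending to x form a Cauchy sequence, whose limit defines [g x]. The last
    clause allows g to be compared with the process at real times. *)
Lemma rational_extension {R : realType} (u : R -> R) :
  (forall x e : R, 0 < e -> exists2 eta, 0 < eta & forall q q' : rat,
    `|x - ratr q| < eta -> `|x - ratr q'| < eta -> `|u (ratr q) - u (ratr q')| <= e) ->
  exists2 g : R -> R, continuous g & forall x e : R, 0 < e ->
    exists2 eta, 0 < eta & forall q : rat,
      `|x - ratr q| < eta -> `|u (ratr q) - g x| <= e.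
Proof.
move=> osc.
have lim_u (x : R) : exists l : R, forall e : R, 0 < e ->
    exists2 eta, 0 < eta & forall q : rat,
    `|x - ratr q| < eta -> `|u (ratr q) - l| <= e.
  have invS0 k : 0 < k.+1%:R^-1 :> R by rewrite invr_gt0.
  have [r rP] := choice (fun k => rational_near x (invS0 k)).
  pose v k := u (ratr (r k)).
  have r_near eta : 0 < eta -> \forall k \near \oo, `|x - ratr (r k)| < eta.
    move=> eta0; near=> k; apply: lt_trans (rP k) _.
    by near: k; exact: (near_infty_natSinv_lt (PosNum eta0)).
  have /cauchy_cvgP/cvg_ex[l vl] : cauchy (v @ \oo).
    apply: cauchy_exP => e e0.
    have e20 : 0 < e / 2 by rewrite divr_gt0.
    have [eta eta0 etaP] := osc x (e / 2) e20.
    have [q xq] := rational_near x eta0.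
    exists (u (ratr q)); apply: filterS (r_near eta eta0) => k xk.
    rewrite /ball /=; apply: le_lt_trans (etaP _ _ xq xk) _.
    by rewrite gtr_pMr// invf_lt1// ltr1n.
  exists l => e e0.
  have [eta eta0 etaP] := osc x e e0; exists eta => // q xq.
  have uv : `|u (ratr q) - v k| @[k --> \oo] --> `|u (ratr q) - l|.
    by apply: cvg_norm; apply: cvgB => //; exact: cvg_cst.
  apply: (cvgr_to_le uv); apply: filterS (r_near eta eta0) => k xk.
  exact: etaP.
have [g gP] := choice lim_u; exists g => // x.
apply/cvgrPdist_le => e e0.
have e20 : 0 < e / 2 by rewrite divr_gt0.
have [eta eta0 etaP] := gP x _ e20.
near=> y.
have xy : `|x - y| < eta by near: y; exact: (nbhsx_ballx x eta eta0).
have [eta' eta'0 eta'P] := gP y _ e20.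
(* The second bound keeps the rational near y within [eta] of x as well. *)
have min0 : 0 < Num.min eta' (eta - `|x - y|) by rewrite lt_min eta'0 subr_gt0.
have [q] := rational_near y min0; rewrite lt_min => /andP[yq1 yq2].
have xq : `|x - ratr q| < eta.
  by apply: le_lt_trans (ler_distD y _ _) _; rewrite addrC -ltrBrDr.
rewrite [e]splitr; apply: le_trans (ler_distD (u (ratr q)) _ _) _.
by rewrite lerD//; [rewrite distrC; exact: etaP|exact: eta'P].
Unshelve. all: by end_near. Qed.

(** * From a natural modification to sample continuity *)

(** An inclusion, since B may be empty while the range of a sequence is not. *)
Lemma cover_by_sequence {T : Type} (B : set (set T)) : countable B ->
  exists b : nat -> set T, B `<=` range b.
Proof.
move=> /pfcard_geP[->|[b]]; first by exists (fun=> set0).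
exists b => V BV; have [n _ <-] := @surj _ _ _ _ b V BV.
by exists n.
Qed.

Section natural_modification.
Context {R : realType} d {Omega : measurableType d} (P : probability Omega R).
Context (X : R -> {RV P >-> R}) (T : set R).

(** U comes from the base alone and precedes c, so that a dense sequence can be adapted to it.
    Continuity at t gives a base set where the path stays within e/2 of its value at t. *)
Lemma natural_modification_cover : has_natural_modification (sigL T X) ->
  exists (U : nat -> set R), forall (c : nat -> R) e, 0 < e ->
  {ae P, forall w, forall t, T t ->
    exists n, U n t /\ osc_set [set i | U n (c i)] e (fun i => X (c i) w)}.
Proof.
move=> [xi Xxi [top [[B countB [oB baseB]] cont_xi]]].
have [b Bb] := cover_by_sequence countB.
exists (fun n => (@set_val _ T) @` (b n)) => c e e0.
(* For [c i] outside T the claim is vacuous; the remaining times are countably many. *)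
have xiX : {ae P, forall w, forall i (s : T), set_val s = c i -> xi w s = X (c i) w}.
  apply/ae_foralln => i.
  have [Tci|nTci] := pselect (T (c i)); last first.
    by apply/aeW => w s sci; case: nTci; rewrite -sci; exact: set_valP.
  have := Xxi (SigSub (mem_set Tci)); apply: filterS => w xiw s sci.
  have -> : s = SigSub (mem_set Tci) by apply/val_inj.
  by rewrite xiw.
near=> w => t Tt.
have xiXw : forall i (s : T), set_val s = c i -> xi w s = X (c i) w.
  by near: w.
have cont_w : continuous (xi w : Topological.Pack top -> R) by near: w.
pose t0 : T := SigSub (mem_set Tt).
have e20 : 0 < e / 2 by rewrite divr_gt0.
have /cvgrPdist_le/(_ _ e20) near_t := cont_w t0.
have [V [BV Vt0] Vnear] := baseB t0 _ near_t.
have [n _ bnV] := Bb _ BV.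
exists n; split; first by exists t0; rewrite ?bnV.
move=> i j [s bs si] [s' bs' sj].
rewrite -(xiXw _ _ si) -(xiXw _ _ sj).
rewrite [e]splitr; apply: le_trans (ler_distD (xi w t0) _ _) _.
rewrite bnV in bs bs'.
by rewrite lerD//; [rewrite distrC; exact: Vnear|exact: Vnear].
Unshelve. all: by end_near. Qed.

End natural_modification.

Theorem theorem4 (R : realType) (d : measure_display)
    (Omega : measurableType d) (P : probability Omega R)
    (HP : standard_probability P) (X : R -> {RV P >-> R})
    (Xmeas : measurable_process X) (Xstat : stationary X) :
  sample_continuous X \/
  (forall T : set R, non_null T -> ~ has_natural_modification (sigL T X)).
Proof.
have [[T [T0 natT]]|none] := pselect (exists T : set R,
    non_null T /\ has_natural_modification (sigL T X)); last first.
  by right => T T0 natT; apply: none; exists T.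
left; have [f Xf mf] := Xmeas.
have [U UP] := natural_modification_cover natT.
have [c cU] := dense_sequence U.
(* [D t] lists t at index 0 and then the rationals, with 0 at indices that code no rational. *)
pose D (t : R) i : R := if i is j.+1 then
  (if unpickle j is Some q then ratr q else 0) else t.
have Dq t (q : rat) : D t (pickle q).+1 = ratr q by rewrite /D pickleK.
pose good t w := forall k x, exists2 eta : R, 0 < eta & forall i j,
  `|x - D t i| < eta -> `|x - D t j| < eta ->
  `|f w (D t i) - f w (D t j)| <= k.+1%:R^-1.
have ae_good t : {ae P, forall w, good t w}.
  apply/ae_foralln => k.
  have k0 : 0 < k.+1%:R^-1 :> R by rewrite invr_gt0.
  exact: (@ae_osc_small _ _ _ _ _ _ HP Xf mf Xstat T U c (D t) _ T0 cU (UP c _ k0)).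
(* The path must not depend on t, so it is built from the rationals in [D 0]. *)
have extend w : exists g : R -> R, good 0 w -> continuous g /\
    forall x e : R, 0 < e -> exists2 eta, 0 < eta & forall q : rat,
      `|x - ratr q| < eta -> `|f w (ratr q) - g x| <= e.
  have [gw|ngw] := pselect (good 0 w); last by exists (fun=> 0).
  have [|g cg gP] := @rational_extension _ (f w); last by exists g.
  move=> x e /natSinv_lt[k ke]; have [eta eta0 etaP] := gw k x.
  exists eta => // q q' xq xq'; apply: le_trans (ltW ke).
  by have := etaP (pickle q).+1 (pickle q').+1; rewrite !Dq; apply.
have [xi xiP] := choice extend.
exists xi; last by apply: filterS (ae_good 0) => w /xiP[].
(* The null set may now depend on t. As [D t] contains t, both [f w t] and [xi w t] are close to
   [f w] at rationals near t. *)
move=> t; near=> w.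
have -> : X t w = f w t by apply/esym; near: w; exact: Xf.
have good0 : good 0 w by near: w; exact: ae_good.
have goodt : good t w by near: w; exact: ae_good.
have [_ near_xi] := xiP w good0.
apply/eqP; rewrite -subr_eq0 -normr_le0; apply/ler_addgt0Pr => e e0.
rewrite add0r.
have e20 : 0 < e / 2 by rewrite divr_gt0.
have [eta1 eta10 eta1P] := near_xi t _ e20.
have [k ke] := natSinv_lt e20.
have [eta2 eta20 eta2P] := goodt k t.
have min0 : 0 < Num.min eta1 eta2 by rewrite lt_min eta10.
have [q] := rational_near t min0; rewrite lt_min => /andP[tq1 tq2].
rewrite [e]splitr; apply: le_trans (ler_distD (f w (ratr q)) _ _) _.
rewrite lerD//; first by rewrite distrC; exact: eta1P.
apply: le_trans (ltW ke); have := eta2P (pickle q).+1 0%N.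
by rewrite Dq /= subrr normr0; apply.
Unshelve. all: by end_near. Qed.
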